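(* Let $\mathcal{G}=(\mathcal{V},\mathcal{E})$ be a digraph on $n>1$ nodes and fix updating weights $a_{ij}$ and sending weights $b_{ih}$ as described in the context. Then $\mathcal{G}$ is strongly connected if and only if there exists $\bar\epsilon>0$ such that for every $\epsilon\in(0,\bar\epsilon)$ the deterministic algorithm with parameter $\epsilon$ achieves average consensus.
   Context: Setting: $\mathcal{V}=\{1,\dots,n\}$ with $n>1$, $\mathcal{E}\subseteq\mathcal{V}\times\mathcal{V}$, and no selfloops, i.e. $(i,i)\notin\mathcal{E}$. An edge $(j,i)$ means that $j$ sends information to $i$. Write $\mathcal{N}_i^+=\{j:(j,i)\in\mathcal{E}\}$ and $\mathcal{N}_i^-=\{h:(i,h)\in\mathcal{E}\}$. Weights: the updating weights satisfy $a_{ij}\in(0,1)$ if $j\in\mathcal{N}_i^+$, $a_{ij}=0$ otherwise, and $\sum_{j\in\mathcal{N}_i^+}a_{ij}<1$. The sending weights satisfy $b_{ih}\in(0,1)$ if $h\in\mathcal{N}_i^-$, $b_{ih}=0$ otherwise, and $\sum_{h\in\mathcal{N}_i^-}b_{ih}<1$. Matrices: let $A=[a_{ij}]$, $D=\mathrm{diag}(d_1,\dots,d_n)$ with $d_i=\sum_j a_{ij}$, and $L=D-A$. Let $B=[b_{ih}]^T$ (so the $(h,i)$ entry of $B$ is $b_{ih}$), $\tilde D=\mathrm{diag}(\tilde d_1,\dots,\tilde d_n)$ with $\tilde d_i=\sum_h b_{ih}$, and $S=(I-\tilde D)+B$. For a parameter $\epsilon>0$ define $$M=\begin{bmatrix}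 I-L & \epsilon I\\ L & S-\epsilon I\end{bmatrix}\in\mathbb{R}^{2n\times 2n}.$$ Deterministic algorithm: state $x(k)\in\mathbb{R}^n$ and surplus $s(k)\in\mathbb{R}^n$ evolve by $\begin{bmatrix}x(k+1)\\ s(k+1)\end{bmatrix}=M\begin{bmatrix}x(k)\\ s(k)\end{bmatrix}$ for $k\ge 0$, starting from $s(0)=0$. Average consensus: the algorithm achieves average consensus if for every $x(0)\in\mathbb{R}^n$ (with $s(0)=0$) we have $(x(k),s(k))\to(x_a\mathbf{1},0)$ as $k\to\infty$, where $x_a=\mathbf{1}^Tx(0)/n$ and $\mathbf{1}$ is the all-ones vector. *)

(* Defs.v *)
From HB Require Import structures.
From mathcomp Require Import all_boot all_order all_algebra.
From mathcomp Require Import all_classical all_reals all_analysis.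
Set Implicit Arguments. Unset Strict Implicit. Unset Printing Implicit Defensive.
Import Order.TTheory GRing.Theory Num.Theory numFieldNormedType.Exports.
Local Open Scope classical_set_scope.
Local Open Scope ring_scope.

(* Nodes are 'I_n.  E j i = true means the edge (j,i): j sends to i. *)

Definition strongly_connected (n : nat) (E : rel 'I_n) : Prop :=
  forall i j : 'I_n, connect E i j.

Definition updating_weights (R : realType) (n : nat) (E : rel 'I_n)
    (a : 'M[R]_n) : Prop :=
  (forall i j, E j i -> 0 < a i j < 1) /\
  (forall i j, ~~ E j i -> a i j = 0) /\
  (forall i, \sum_j a i j < 1).

Definition sending_weights (R : realType) (n : nat) (E : rel 'I_n)
    (b : 'M[R]_n) : Prop :=
  (forall i h, E i h -> 0 < b i h < 1) /\
  (forall i h, ~~ E i h -> b i h = 0) /\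
  (forall i, \sum_h b i h < 1).

Section Algo.
Variables (R : realType) (n : nat).

Definition Amx (a : 'M[R]_n) : 'M[R]_n := a.
Definition Dmx (a : 'M[R]_n) : 'M[R]_n := diag_mx (\row_i \sum_j a i j).
Definition Lmx (a : 'M[R]_n) : 'M[R]_n := Dmx a - Amx a.
Definition Bmx (b : 'M[R]_n) : 'M[R]_n := b^T.
Definition Dtmx (b : 'M[R]_n) : 'M[R]_n := diag_mx (\row_i \sum_h b i h).
Definition Smx (b : 'M[R]_n) : 'M[R]_n := (1%:M - Dtmx b) + Bmx b.

Definition Mmx (a b : 'M[R]_n) (eps : R) : 'M[R]_(n + n) :=
  block_mx (1%:M - Lmx a) (eps%:M) (Lmx a) (Smx b - eps%:M).

Definition traj (a b : 'M[R]_n) (eps : R) (x0 : 'cV[R]_n) (k : nat)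
  : 'cV[R]_(n + n) := iter k (mulmx (Mmx a b eps)) (col_mx x0 0).

Definition xstate a b eps x0 k : 'cV[R]_n := usubmx (traj a b eps x0 k).
Definition sstate a b eps x0 k : 'cV[R]_n := dsubmx (traj a b eps x0 k).

Definition average (x0 : 'cV[R]_n) : R := (\sum_i x0 i 0) / n%:R.

Definition achieves_average_consensus (a b : 'M[R]_n) (eps : R) : Prop :=
  forall x0 : 'cV[R]_n,
    (forall i : 'I_n,
        (fun k => xstate a b eps x0 k i 0) @ \oo --> average x0) /\
    (forall i : 'I_n,
        (fun k => sstate a b eps x0 k i 0) @ \oo --> (0 : R)).

End Algo.

(* Main.v *)
Require Import Defs.
From HB Require Import structures.
From mathcomp Require Import all_boot all_order all_algebra.
From mathcomp Require Import all_classical all_reals all_analysis.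
From mathcomp Require Import ring lra.
Set Implicit Arguments. Unset Strict Implicit. Unset Printing Implicit Defensive.
Import Order.TTheory GRing.Theory Num.Theory numFieldNormedType.Exports.
Local Open Scope classical_set_scope.
Local Open Scope ring_scope.

(* If node j is not reachable from node i, the nodes reachable from i send nothing to the
   others, so starting from their indicator the state at j stays 0 although the average is
   positive; hence consensus for a single eps already forces strong connectivity.

   Conversely P := I - L is row stochastic, S is column stochastic, and strong connectivity
   with positive diagonals makes both primitive. Let pi be the left Perron vector of P and
   sg the right Perron vector of S. Put z := x - x_a 1, so that 1^T (z + s) = 0, and split
   z = c 1 + p with pi p = 0 and s = m sg + q with 1^T q = 0. Conservation gives
   m = - (n c + 1^T p), so c is damped by the factor 1 - eps n (pi sg), with an O(eps)
   perturbation in p and q; p is contracted by P up to O(eps); and q is contracted by S,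
   up to O(eps), with forcing O(p). Hence a weighted sum |c| + w1 |p| + w2 |q|, in norms
   adapted to P and S, is a Lyapunov function that contracts for all small eps. *)

(** * Positivity preliminaries *)

Lemma fin_pos_lower_bound (R : realFieldType) (T : finType) (f : T -> R) :
  (forall t, 0 < f t) -> exists2 g, 0 < g & forall t, g <= f t.
Proof.
move=> f_gt0; exists (\big[Num.min/1]_t f t).
  by elim/big_ind: _ => // x y x0 y0; rewrite lt_min x0.
by move=> t; apply: bigmin_le_cond.
Qed.

Lemma mulmx_ge0 (R : realFieldType) (m n p : nat) (A : 'M[R]_(m, n)) (B : 'M[R]_(n, p)) :
  (forall i j, 0 <= A i j) -> (forall i j, 0 <= B i j) ->
  forall i j, 0 <= (A *m B) i j.
Proof. by move=> A0 B0 i j; rewrite mxE sumr_ge0 // => k _; rewrite mulr_ge0. Qed.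

Lemma mulmx_gt0 (R : realFieldType) (m n p : nat) (A : 'M[R]_(m, n)) (B : 'M[R]_(n, p))
    i k j :
  (forall i j, 0 <= A i j) -> (forall i j, 0 <= B i j) ->
  0 < A i k -> 0 < B k j -> 0 < (A *m B) i j.
Proof.
move=> A0 B0 Aik Bkj; rewrite mxE (bigD1 k) //= ltr_pwDl ?mulr_gt0 //.
by rewrite sumr_ge0 // => l _; rewrite mulr_ge0.
Qed.

(** * Primitive nonnegative matrices: Perron vectors and contracting norms *)

Section Primitive.
Variables (R : realFieldType) (n : nat).
Implicit Types (Q : 'M[R]_n) (mu : 'rV[R]_n) (nu : 'cV[R]_n).

Lemma expmx_ge0 Q k : (forall i j, 0 <= Q i j) -> forall i j, 0 <= (Q ^+ k) i j.
Proof.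
move=> Q0; elim: k => [|k IH]; last by rewrite exprS; apply: mulmx_ge0.
by move=> i j; rewrite expr0 mxE ler0n.
Qed.

Lemma fixed_expmx Q k mu : mu *m Q = mu -> mu *m Q ^+ k = mu.
Proof.
by move=> muQ; elim: k => [|k IH]; rewrite ?expr0 ?mulmx1 // exprS mulmxA muQ.
Qed.

Lemma trmx_exp Q k : (Q ^+ k)^T = Q^T ^+ k.
Proof.
by elim: k => [|k IH]; rewrite ?expr0 ?trmx1 // exprSr exprS [LHS]trmx_mul IH.
Qed.

(** A walk can idle at [i], where the diagonal entry is positive, to use up the extra steps. *)
Lemma expmx_gt0_le Q i j k l :
  (forall i j, 0 <= Q i j) -> (forall i, 0 < Q i i) ->
  (k <= l)%N -> 0 < (Q ^+ k) i j -> 0 < (Q ^+ l) i j.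
Proof.
move=> Q0 Qd /subnK <- Qk; elim: (l - k)%N => [//|d IH].
by rewrite addSn exprS; apply: (mulmx_gt0 (k := i)) => //; apply: expmx_ge0.
Qed.

(** A walk of length [k] from [j] to [i] makes the entry of [Q ^+ k] at row [i], column [j]
    positive; idling then brings all pairs to one common exponent. *)
Lemma primitive_expmx Q (E : rel 'I_n) :
  (forall i j, 0 <= Q i j) -> (forall i, 0 < Q i i) ->
  (forall i j, E j i -> 0 < Q i j) -> (forall i j, connect E i j) ->
  exists N, forall i j, 0 < (Q ^+ N.+1) i j.
Proof.
move=> Q0 Qd QE sc.
have pow i j : exists k, 0 < (Q ^+ k) i j.
  have /connectP[p] := sc j i.
  elim/last_ind: p i => [|p h IH] i /=.
    by move=> _ ->; exists 0%N; rewrite expr0 mxE eqxx ltr01.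
  rewrite rcons_path last_rcons => /andP[Ep El] ->.
  have [k Qk] := IH _ Ep erefl; exists k.+1; rewrite exprS.
  by apply: (mulmx_gt0 (k := last j p)) => //; [apply: expmx_ge0|apply: QE].
pose K i j := ex_minn (pow i j).
exists (\max_i \max_j K i j)%N => i j.
apply: (@expmx_gt0_le Q i j (K i j)) => //; last by rewrite /K; case: ex_minnP.
apply: leqW; apply: leq_trans (leq_bigmax (F := fun i => \max_j K i j)%N i).
exact: (leq_bigmax (F := K i) j).
Qed.

(** Since [nu] is a right fixed vector, [Q] also has a nonzero left fixed vector [w]. The triangle
    inequality gives |w| <= |w| Q entrywise, pairing with the positive [nu] forces equality, and
    [Q ^+ N] spreads one nonzero entry of |w| to all coordinates. *)
Lemma left_perron_vector Q N nu :
  (0 < n)%N -> (forall i j, 0 <= Q i j) -> (forall i j, 0 < (Q ^+ N) i j) ->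
  (forall i, 0 < nu i 0) -> Q *m nu = nu ->
  exists mu, [/\ forall i, 0 < mu 0 i, mu *m Q = mu & mu *m nu = 1%:M].
Proof.
move=> n0 Q0 QN nu0 Qnu; pose i0 := Ordinal n0.
have det0 : \det (Q - 1%:M) == 0.
  rewrite -det_tr; apply/det0P; exists nu^T.
    by apply/eqP => /matrixP/(_ 0 i0); rewrite !mxE => h; have := nu0 i0; rewrite h ltxx.
  by rewrite -trmx_mul mulmxBl Qnu mul1mx subrr trmx0.
have [w w0 wQ] := elimT det0P det0; have {wQ}wQ : w *m Q = w.
  by apply/eqP; rewrite -subr_eq0 -{2}[w]mulmx1 -mulmxBr wQ.
pose v : 'rV[R]_n := \row_i `|w 0 i|.
have vQ_ge i : 0 <= (v *m Q - v) 0 i.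
  have -> : (v *m Q - v) 0 i = \sum_j `|w 0 j| * Q j i - `|w 0 i|.
    by rewrite !mxE; congr (_ - _); apply: eq_bigr => j _; rewrite mxE.
  rewrite subr_ge0 -{1}wQ mxE; apply: le_trans (ler_norm_sum _ _ _) _.
  by apply: ler_sum => j _; rewrite normrM (ger0_norm (Q0 _ _)).
have vQ : v *m Q = v.
  apply/eqP; rewrite -subr_eq0; apply/eqP/rowP => i; rewrite [RHS]mxE.
  have : ((v *m Q - v) *m nu) 0 0 = 0 by rewrite mulmxBl -mulmxA Qnu subrr mxE.
  rewrite mxE => /eqP; rewrite psumr_eq0; last by move=> j _; rewrite mulr_ge0 // ltW.
  by move=> /allP/(_ i (mem_index_enum _))/=; rewrite mulf_eq0 (gt_eqF (nu0 i)) orbF => /eqP.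
have v_ge0 i j : 0 <= v i j by rewrite mxE.
have [k wk] : exists k, w 0 k != 0.
  apply/existsP; apply: contraNT w0; rewrite negb_exists => /forallP h.
  by apply/eqP/rowP => i; rewrite mxE; apply/eqP; have := h i; rewrite negbK.
have v_gt0 i : 0 < v 0 i.
  rewrite -(fixed_expmx N vQ); apply: (mulmx_gt0 (k := k)) => //; last by rewrite mxE normr_gt0.
  exact: expmx_ge0.
have vnu : 0 < (v *m nu) 0 0.
  apply: (mulmx_gt0 (k := i0)) => // i j; rewrite ord1; exact: ltW.
exists (((v *m nu) 0 0)^-1 *: v); split.
- by move=> i; rewrite mxE mulr_gt0 ?invr_gt0.
- by rewrite -scalemxAl vQ.
- rewrite -scalemxAl; apply/matrixP => i j; rewrite !ord1 !mxE eqxx mulVf //.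
  by have := vnu; rewrite mxE => /gt_eqF ->.
Qed.

Lemma right_perron_vector Q N mu :
  (0 < n)%N -> (forall i j, 0 <= Q i j) -> (forall i j, 0 < (Q ^+ N) i j) ->
  (forall i, 0 < mu 0 i) -> mu *m Q = mu ->
  exists nu, [/\ forall i, 0 < nu i 0, Q *m nu = nu & mu *m nu = 1%:M].
Proof.
move=> n0 Q0 QN mu0 muQ.
have [||||nu [nu0 nuQ numu]] := @left_perron_vector Q^T N mu^T n0.
- by move=> i j; rewrite mxE.
- by move=> i j; rewrite -trmx_exp mxE.
- by move=> i; rewrite mxE.
- by rewrite -trmx_mul muQ.
exists nu^T; split.
- by move=> i; rewrite mxE.
- by rewrite -[Q]trmxK -trmx_mul nuQ.
- by rewrite -[mu]trmxK -trmx_mul numu trmx1.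
Qed.

(** The third clause is definiteness in quantitative form: domination of the plain l1 norm. It also
    yields nonnegativity and lets different norms be compared without compactness. *)
Definition is_vnorm m (F : 'cV[R]_m -> R) : Prop :=
  [/\ forall x y, F (x + y) <= F x + F y,
      forall c x, F (c *: x) = `|c| * F x &
      exists2 C : R, 0 < C & forall x : 'cV[R]_m, \sum_i `|x i 0| <= C * F x].

Lemma vnorm_ge0 m (F : 'cV[R]_m -> R) x : is_vnorm F -> 0 <= F x.
Proof.
case=> _ _ [C C0 FC]; rewrite -(pmulr_rge0 _ C0).
by apply: le_trans (FC x); apply: sumr_ge0.
Qed.

Lemma vnorm_scalar : is_vnorm (fun x : 'cV[R]_1 => `|x 0 0|).
Proof.
split=> [x y|c x|]; first by rewrite mxE ler_normD.
  by rewrite mxE normrM.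
by exists 1 => // x; rewrite big_ord1 mul1r.
Qed.

(** Expand [T *m x] over the columns of [T]; the coefficients are controlled by the l1 bound for
    [G]. *)
Lemma vnorm_mulmx_bound m p (F : 'cV[R]_m -> R) (G : 'cV[R]_p -> R) (T : 'M[R]_(m, p)) :
  is_vnorm F -> is_vnorm G -> exists2 K, 0 <= K & forall x, F (T *m x) <= K * G x.
Proof.
move=> nF nG; have F_ge0 x := vnorm_ge0 x nF; have G_ge0 x := vnorm_ge0 x nG.
case: nF => FD FZ _; case: nG => _ _ [C C0 GC].
have F0 : F 0 = 0 by rewrite -(scale0r 0) FZ normr0 mul0r.
pose M := \sum_j F (col j T).
have M0 : 0 <= M by apply: sumr_ge0.
exists (M * C) => [|x]; first by rewrite mulr_ge0 // ltW.
rewrite -mulrA; apply: le_trans (ler_wpM2l M0 (GC x)).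
have -> : T *m x = \sum_j x j 0 *: col j T.
  by apply/colP => i; rewrite mxE summxE; apply: eq_bigr => j _; rewrite !mxE mulrC.
apply: (@le_trans _ _ (\sum_j `|x j 0| * F (col j T))).
  elim/big_ind2: _ => [|u v u' v' h h'|j _]; rewrite ?F0 ?FZ //.
  by apply: le_trans (FD _ _) (lerD h h').
rewrite mulrC mulr_suml; apply: ler_sum => j _; apply: ler_wpM2l => //.
by rewrite /M (bigD1 j) //= lerDl sumr_ge0.
Qed.

(* Q^(N+1) dominates g nu mu, and nu mu vanishes on the kernel of mu, so N+1 steps shrink the
   mu-weighted l1 norm there; summing that norm over N+1 iterates gives a one-step contraction. *)
Lemma primitive_contraction Q N mu nu :
  (forall i j, 0 <= Q i j) -> (forall i j, 0 < (Q ^+ N.+1) i j) ->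
  (forall i, 0 < mu 0 i) -> (forall i, 0 < nu i 0) ->
  mu *m Q = mu -> mu *m nu = 1%:M ->
  exists F g, [/\ is_vnorm F, 0 < g &
    forall x, mu *m x = 0 -> F (Q *m x) <= (1 - g) * F x].
Proof.
move=> Q0 QN mu0 nu0 muQ munu.
pose l1 (x : 'cV[R]_n) := \sum_i mu 0 i * `|x i 0|.
have l1_ge0 x : 0 <= l1 x.
  by apply: sumr_ge0 => i _; rewrite mulr_ge0 // ltW.
(* The [mu]-weighted column sums of [T] are [t *: mu], so [t] bounds its operator norm for [l1]. *)
have l1_mul (T : 'M[R]_n) t x : (forall i j, 0 <= T i j) -> mu *m T = t *: mu ->
    l1 (T *m x) <= t * l1 x.
  move=> T0 muT; rewrite /l1.
  apply: (@le_trans _ _ (\sum_i \sum_j mu 0 i * T i j * `|x j 0|)).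
    apply: ler_sum => i _; under [leRHS]eq_bigr do rewrite -mulrA.
    rewrite -mulr_sumr; apply: ler_wpM2l; first exact: ltW.
    rewrite mxE; apply: le_trans (ler_norm_sum _ _ _) _.
    by apply: ler_sum => j _; rewrite normrM (ger0_norm (T0 _ _)).
  rewrite exchange_big mulr_sumr; apply: ler_sum => j _.
  rewrite -mulr_suml mulrA; have /rowP/(_ j) := muT.
  by rewrite mxE [X in _ = X]mxE => ->.
have [g g0 Qg] : exists2 g, 0 < g & forall i j, g * (nu i 0 * mu 0 j) <= (Q ^+ N.+1) i j.
  have [|g g0 h] := @fin_pos_lower_bound R ('I_n * 'I_n)%type
     (fun ij => (Q ^+ N.+1) ij.1 ij.2 / (nu ij.1 0 * mu 0 ij.2)).
    by move=> [i j] /=; rewrite divr_gt0 ?mulr_gt0.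
  by exists g => // i j; have := h (i, j); rewrite ler_pdivlMr ?mulr_gt0.
have l1N x : mu *m x = 0 -> l1 (Q ^+ N.+1 *m x) <= (1 - g) * l1 x.
  move=> mux.
  (* Subtracting the rank-one matrix changes nothing on the kernel of [mu], keeps the entries
     nonnegative by the choice of [g], and lowers the left eigenvalue at [mu] from 1 to [1 - g]. *)
  have -> : Q ^+ N.+1 *m x = (Q ^+ N.+1 - g *: (nu *m mu)) *m x.
    by rewrite mulmxBl -scalemxAl -mulmxA mux mulmx0 scaler0 subr0.
  apply: l1_mul.
    by move=> i j; rewrite !mxE big_ord1 subr_ge0.
  by rewrite mulmxBr (fixed_expmx _ muQ) -scalemxAr mulmxA munu mul1mx scalerBl scale1r.
have l1Q k x : l1 (Q ^+ k *m x) <= l1 x.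
  rewrite -[leRHS]mul1r; apply: l1_mul; first exact: expmx_ge0.
  by rewrite (fixed_expmx _ muQ) scale1r.
pose F (x : 'cV[R]_n) := \sum_(k < N.+1) l1 (Q ^+ k *m x).
(* Applying [Q] telescopes the sum [F]: the net loss is [l1 x - l1 (Q ^+ N.+1 *m x)], at least
   [g * l1 x], while [F x] is at most [N.+1] times [l1 x]. *)
exists F, (g / N.+1%:R); split.
- split.
  + move=> x y; rewrite /F -big_split; apply: ler_sum => k _ /=.
    rewrite mulmxDr /l1 -big_split; apply: ler_sum => i _ /=.
    by rewrite mxE -mulrDr; apply: ler_wpM2l; [apply: ltW|apply: ler_normD].
  + move=> c x; rewrite /F mulr_sumr; apply: eq_bigr => k _.
    rewrite -scalemxAr /l1 mulr_sumr; apply: eq_bigr => i _.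
    by rewrite mxE normrM mulrCA.
  + have [c c0 hc] := fin_pos_lower_bound mu0.
    exists c^-1 => [|x]; first by rewrite invr_gt0.
    rewrite ler_pdivlMl //; apply: (@le_trans _ _ (l1 x)).
      by rewrite mulr_sumr; apply: ler_sum => i _; apply: ler_wpM2r.
    by rewrite /F big_ord_recl expr0 mul1mx lerDl sumr_ge0.
- by rewrite divr_gt0 // ltr0n.
move=> x mux.
have -> : F (Q *m x) = F x + (l1 (Q ^+ N.+1 *m x) - l1 x).
  have Qs k : Q ^+ k *m (Q *m x) = Q ^+ k.+1 *m x by rewrite mulmxA exprSr.
  rewrite /F big_ord_recr big_ord_recl /= Qs expr0 mul1mx.
  under eq_bigr do rewrite Qs.
  set A := \sum_(i < N) _; set B := l1 (_ *m x); ring.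
have FN : F x <= N.+1%:R * l1 x.
  rewrite /F; apply: (@le_trans _ _ (\sum_(k < N.+1) l1 x)).
    by apply: ler_sum => k _.
  by rewrite sumr_const card_ord mulr_natl.
have {}FN : g / N.+1%:R * F x <= g * l1 x.
  by rewrite -mulrA ler_wpM2l ?(ltW g0) // ler_pdivrMl ?ltr0n.
move: (l1N x mux) FN; rewrite !mulrBl !mul1r.
move: (F x) (l1 x) (l1 (Q ^+ N.+1 *m x)) (g * l1 x) (g / _ * F x) => u v w y z; lra.
Qed.

End Primitive.

(** Here [u], [v], [w] stand for |c|, |p|, |q|. The forcing of [w] by [v] is not small in [eps], so
    [q] must be small relative to [p]; the damping of [u] is only of order [eps], so [p] must be
    small as well. *)
Lemma lyapunov_weights (R : realFieldType) (K al g : R) :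
  0 < K -> 0 < al -> 0 < g ->
  exists p q epsb, [/\ 0 < p, 0 < q, 0 < epsb & forall eps, 0 < eps < epsb ->
    [/\ eps * al <= 1, 0 <= 1 - eps * al / 2 < 1 &
    forall u v w u' v' w', 0 <= u -> 0 <= v -> 0 <= w ->
      u' <= (1 - eps * al) * u + eps * K * (v + w) ->
      v' <= (1 - g) * v + eps * K * (u + v + w) ->
      w' <= (1 - g + eps) * w + K * v ->
      u' + p * v' + q * w' <= (1 - eps * al / 2) * (u + p * v + q * w)]].
Proof.
move=> K0 al0 g0.
(* p K spends half of the damping al of u, and q K a quarter of the damping p g of v. *)
pose p := al / (2 * K); have p0 : 0 < p by rewrite divr_gt0 // mulr_gt0.
have pK : p * K = al / 2 by rewrite /p; field; rewrite gt_eqF.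
clearbody p; pose q := p * g / (4 * K); have q0 : 0 < q by rewrite divr_gt0 // mulr_gt0.
have qK : q * K = p * g / 4 by rewrite /q; field; rewrite gt_eqF.
(* [dv] and [dw] gather the coefficients of [eps] in [cv] and [cw] below. They must fit into the
   damping still available, [3 * p * g / 4] and [q * g]; the bound [al^-1] keeps [1 - eps * al]
   nonnegative. *)
clearbody q; pose dv := K + p * K + p * al / 2; have dv0 : 0 < dv by rewrite /dv; nra.
pose dw := K + p * K + q + q * al / 2; have dw0 : 0 < dw by rewrite /dw; nra.
exists p, q, (Num.min al^-1 (Num.min (3 * p * g / 4 / dv) (q * g / dw))).
split => //.
  by rewrite !lt_min invr_gt0 al0 !divr_gt0 ?mulr_gt0.
move=> eps /andP[e0]; rewrite !lt_min => /and3P[h1 h2 h3].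
have eal : eps * al <= 1 by rewrite ltW // -ltr_pdivlMr // mul1r.
have eal0 : 0 < eps * al by rewrite mulr_gt0.
split=> //; first by apply/andP; split; lra.
move: h2 h3; rewrite !ltr_pdivlMr // => h2 h3 u v w u' v' w' u0 v0 w0 hu hv hw.
have hpv := ler_wpM2l (ltW p0) hv; have hqw := ler_wpM2l (ltW q0) hw.
have cv : eps * K + p * (1 - g) + eps * (p * K) + q * K <= (1 - eps * al / 2) * p.
  by rewrite qK; move: h2; rewrite /dv; lra.
have cw : eps * K + eps * (p * K) + q * (1 - g + eps) <= (1 - eps * al / 2) * q.
  by move: h3; rewrite /dw; lra.
have cu : 1 - eps * al + eps * (p * K) = 1 - eps * al / 2 by rewrite pK; field.
have := ler_wpM2r v0 cv; have := ler_wpM2r w0 cw.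
move: (lerD (lerD hu hpv) hqw).
have -> : (1 - eps * al / 2) * (u + p * v + q * w) =
  (1 - eps * al + eps * (p * K)) * u + (1 - eps * al / 2) * p * v + (1 - eps * al / 2) * q * w.
  by rewrite cu; ring.
lra.
Qed.

(** * One-step contraction of the centred state and surplus *)

Section SurplusContraction.
Variables (R : realFieldType) (n : nat).

Lemma coord_le_l1 (m : nat) (x : 'cV[R]_m) i : `|x i 0| <= \sum_j `|x j 0|.
Proof. by rewrite (bigD1 i) //= lerDl sumr_ge0. Qed.

Lemma mulmx_sub_proj (mu : 'rV[R]_n) (x nu : 'cV[R]_n) :
  mu *m nu = 1%:M -> mu *m (x - (mu *m x) 0 0 *: nu) = 0.
Proof.
by move=> h; rewrite mulmxBr -scalemxAr h scalemx1 -mx11_scalar subrr.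
Qed.

(** The function [W] does not see the component of [s] along [sg], which conservation recovers from
    [z]; hence the bound on [s] is conditional and the one on [z] is not. *)
Lemma surplus_contraction (P S : 'M[R]_n) N N' :
  (0 < n)%N ->
  (forall i j, 0 <= P i j) -> (forall i j, 0 < (P ^+ N.+1) i j) ->
  P *m const_mx 1 = const_mx 1 :> 'cV[R]_n ->
  (forall i j, 0 <= S i j) -> (forall i j, 0 < (S ^+ N'.+1) i j) ->
  const_mx 1 *m S = const_mx 1 :> 'rV[R]_n ->
  exists2 epsb : R, 0 < epsb & forall eps : R, 0 < eps < epsb ->
  exists (W : 'cV[R]_n -> 'cV[R]_n -> R) (C rho : R), [/\ 0 <= rho < 1, 0 <= C,
    forall (z s : 'cV[R]_n) i, `|z i 0| <= C * W z s /\
      (const_mx 1 *m (z + s) = 0 :> 'rV[R]_1 -> `|s i 0| <= C * W z s) &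
    forall z s, const_mx 1 *m (z + s) = 0 :> 'rV[R]_1 ->
      W (P *m z + eps *: s) (z - P *m z + S *m s - eps *: s) <= rho * W z s].
Proof.
move=> n0 P0 PN + S0 SN; set o : 'cV[R]_n := const_mx 1; set e : 'rV[R]_n := const_mx 1.
move=> Po eS.
have o0 i : 0 < o i 0 by rewrite mxE.
have e0 i : 0 < e 0 i by rewrite mxE.
have [pi [pi0 piP pio]] := left_perron_vector n0 P0 PN o0 Po.
have [sg [sg0 Ssg esg]] := right_perron_vector n0 S0 SN e0 eS.
have [F1 [g1 [nF1 g1_gt0 F1P]]] := primitive_contraction P0 PN pi0 o0 piP pio.
have [F2 [g2 [nF2 g2_gt0 F2S]]] := primitive_contraction S0 SN e0 sg0 eS esg.
pose al0 := (pi *m sg) 0 0.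
have al0_gt0 : 0 < al0.
  by apply: (mulmx_gt0 (k := Ordinal n0)) => // i j; rewrite ord1 ltW.
(* [T1] projects onto the kernel of [pi] along [o], and [T2] onto the kernel of [e] along [sg]. The
   constants [K1] to [K5] bound the couplings between the components, and [K] dominates them all. *)
pose T1 := 1%:M - o *m pi; pose T2 := 1%:M - sg *m e.
have [K1 K1_ge0 HK1] := vnorm_mulmx_bound pi (vnorm_scalar R) nF2.
have [K2 K2_ge0 HK2] := vnorm_mulmx_bound e (vnorm_scalar R) nF1.
have [K3 K3_ge0 HK3] := vnorm_mulmx_bound T1 nF1 nF2.
have [K5 K5_ge0 HK5] := vnorm_mulmx_bound (T2 *m (1%:M - P)) nF2 nF1.
pose K4 := F1 (T1 *m sg).
have F1_ge0 x := vnorm_ge0 x nF1; have F2_ge0 x := vnorm_ge0 x nF2.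
have K4_ge0 : 0 <= K4 by apply: F1_ge0.
have nR0 : 0 < n%:R :> R by rewrite ltr0n.
have K4n : 0 <= K4 * n%:R by rewrite mulr_ge0 // ltW.
have K42 : 0 <= K4 * K2 by rewrite mulr_ge0.
have al0K2 : 0 <= al0 * K2 by rewrite mulr_ge0 // ltW.
pose K := al0 * K2 + K1 + K3 + K4 * n%:R + K4 * K2 + K5 + 1.
have K_gt0 : 0 < K by rewrite /K; lra.
have KK1 : K1 <= K by rewrite /K; lra.
have KK2 : al0 * K2 <= K by rewrite /K; lra.
have KK3 : K3 <= K by rewrite /K; lra.
have KK4 : K4 * n%:R <= K by rewrite /K; lra.
have KK42 : K4 * K2 <= K by rewrite /K; lra.
have KK5 : K5 <= K by rewrite /K; lra.
clearbody K; pose g := Num.min g1 g2; have g_gt0 : 0 < g by rewrite lt_min g1_gt0.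
have gg1 : g <= g1 by rewrite ge_min lexx.
have gg2 : g <= g2 by rewrite ge_min lexx orbT.
pose al := n%:R * al0; have al_gt0 : 0 < al by rewrite mulr_gt0.
have [p [q [epsb [p_gt0 q_gt0 epsb_gt0 Hlya]]]] := lyapunov_weights K_gt0 al_gt0 g_gt0.
exists epsb => // eps Heps; have [eps_al rho01 {}Hlya] := Hlya _ Heps.
have /andP[eps_gt0 _] := Heps.
pose cc (z : 'cV[R]_n) := (pi *m z) 0 0.
pose mm (s : 'cV[R]_n) := (e *m s) 0 0.
pose pp z := z - cc z *: o.
pose qq s := s - mm s *: sg.
pose W z s := `|cc z| + p * F1 (pp z) + q * F2 (qq s).
have eo : (e *m o) 0 0 = n%:R.
  by rewrite mxE; under eq_bigr do rewrite !mxE mulr1; rewrite sumr_const card_ord.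
have epp z : (e *m z) 0 0 = n%:R * cc z + (e *m pp z) 0 0.
  rewrite -{1}[z](subrK (cc z *: o)) -/(pp z) mulmxDr -scalemxAr.
  by rewrite [LHS]mxE [X in _ + X]mxE eo; ring.
have mmE z s : e *m (z + s) = 0 -> mm s = - (n%:R * cc z + (e *m pp z) 0 0).
  rewrite -epp mulmxDr => /matrixP/(_ 0 0); rewrite [X in X = _]mxE [X in _ = X]mxE.
  by move=> /eqP; rewrite addrC addr_eq0 => /eqP.
have mm_le z s : e *m (z + s) = 0 -> `|mm s| <= n%:R * `|cc z| + K2 * F1 (pp z).
  move=> /mmE ->; rewrite normrN; apply: le_trans (ler_normD _ _) _.
  by rewrite normrM (ger0_norm (ltW nR0)) lerD2l; apply: HK2.
have [C1 C1_gt0 HC1] : exists2 C, 0 < C & forall x : 'cV_n, \sum_i `|x i 0| <= C * F1 x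
  by case: nF1.
have [C2 C2_gt0 HC2] : exists2 C, 0 < C & forall x : 'cV_n, \sum_i `|x i 0| <= C * F2 x
  by case: nF2.
pose k := \sum_i `|sg i 0|; have k_ge0 : 0 <= k by apply: sumr_ge0.
have W_u z s : `|cc z| <= W z s.
  by rewrite /W -addrA lerDl addr_ge0 // mulr_ge0 // ltW.
have W_v z s : F1 (pp z) <= p^-1 * W z s.
  by rewrite ler_pdivlMl // /W addrAC lerDr addr_ge0 // mulr_ge0 // ltW.
have W_w z s : F2 (qq s) <= q^-1 * W z s.
  by rewrite ler_pdivlMl // /W lerDr addr_ge0 // mulr_ge0 // ltW.
have W_ge0 z s : 0 <= W z s by apply: le_trans (W_u z s).
have ip : 0 < p^-1 by rewrite invr_gt0.
have iq : 0 < q^-1 by rewrite invr_gt0.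
(* [Cz] comes from z = c o + p and [Cs] from s = q + m sg, with m estimated by [mm_le]. *)
pose Cz := 1 + C1 * p^-1; pose Cs := C2 * q^-1 + (n%:R + K2 * p^-1) * k.
have Cz0 : 0 <= Cz by rewrite addr_ge0 // mulr_ge0 // ltW.
have Cs0 : 0 <= Cs by rewrite addr_ge0 // mulr_ge0 ?addr_ge0 ?mulr_ge0 // ltW.
exists W, (Cz + Cs), (1 - eps * al / 2); split.
- exact: rho01.
- exact: addr_ge0.
- move=> z s i; rewrite mulrDl; split.
    apply: (@le_trans _ _ (Cz * W z s)); last by rewrite lerDl mulr_ge0.
    have -> : z i 0 = cc z + pp z i 0 by rewrite !mxE; ring.
    apply: le_trans (ler_normD _ _) _; rewrite mulrDl mul1r -mulrA lerD //.
    apply: le_trans (coord_le_l1 _ _) _; apply: le_trans (HC1 _) _.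
    by rewrite ler_pM2l.
  move=> hzs; apply: (@le_trans _ _ (Cs * W z s)); last by rewrite lerDr mulr_ge0.
  have -> : s i 0 = qq s i 0 + mm s * sg i 0 by rewrite !mxE; ring.
  apply: le_trans (ler_normD _ _) _; rewrite [leRHS]mulrDl lerD //.
    apply: le_trans (coord_le_l1 _ _) _; apply: le_trans (HC2 _) _.
    by rewrite -mulrA ler_pM2l.
  rewrite normrM [leRHS]mulrAC ler_pM //; last exact: coord_le_l1.
  apply: le_trans (mm_le _ _ hzs) _; rewrite mulrDl lerD //.
    by rewrite ler_pM2l.
  by rewrite -mulrA ler_wpM2l.
move=> z s hzs; set z' := P *m z + _; set s' := z - _ + _ - _.
have zE : z = pp z + cc z *: o by rewrite subrK.
have sE : s = qq s + mm s *: sg by rewrite subrK.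
have pis : (pi *m s) 0 0 = (pi *m qq s) 0 0 + mm s * al0.
  by rewrite {1}sE mulmxDr -scalemxAr [LHS]mxE [X in _ + X]mxE.
(* Only the surplus moves the [pi] component, because [pi] is fixed by [P]. *)
have ccz' : cc z' = cc z + eps * (pi *m s) 0 0.
  by rewrite /cc /z' mulmxDr mulmxA piP -scalemxAr [LHS]mxE [X in _ + X]mxE.
apply: Hlya => //.
(* Conservation turns [mm s] into a negative feedback on [cc z], which produces the factor
   [1 - eps * al]. *)
- rewrite ccz' pis (mmE z s hzs).
  have -> : cc z + eps * ((pi *m qq s) 0 0 + - (n%:R * cc z + (e *m pp z) 0 0) * al0) =
    (1 - eps * al) * cc z + eps * ((pi *m qq s) 0 0 - al0 * (e *m pp z) 0 0).
    rewrite /al; ring.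
  apply: le_trans (ler_normD _ _) _; rewrite !normrM (ger0_norm (ltW eps_gt0)).
  rewrite ger0_norm ?subr_ge0 // lerD2l -mulrA ler_pM2l //.
  apply: le_trans (ler_normB _ _) _; rewrite normrM (ger0_norm (ltW al0_gt0)).
  have h1 := HK1 (qq s); have h2 := ler_wpM2l (ltW al0_gt0) (HK2 (pp z)).
  apply: le_trans (lerD h1 h2) _; rewrite addrC mulrDr mulrA.
  by apply: lerD; apply: ler_wpM2r => //.
(* [P] respects the splitting of [z]; the surplus enters through [T1], its part along [sg] being
   bounded by [K4] and [mm_le]. *)
- have -> : pp z' = P *m pp z + eps *: (T1 *m qq s + mm s *: (T1 *m sg)).
    have -> : T1 *m qq s + mm s *: (T1 *m sg) = T1 *m s.
      by rewrite scalemxAr -mulmxDr -sE.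
    rewrite {1}/pp ccz' /z' /pp mulmxBr -scalemxAr Po /T1 mulmxBl mul1mx -mulmxA.
    rewrite [pi *m s]mx11_scalar mul_mx_scalar scalerDl scalerBr scalerA opprD.
    by rewrite addrACA -mx11_scalar.
  case: (nF1) => F1D F1Z _.
  apply: le_trans (F1D _ _) _; apply: lerD.
    apply: le_trans (F1P _ _) _; first exact: mulmx_sub_proj.
    by apply: ler_wpM2r => //; rewrite lerD2l lerN2.
  rewrite F1Z (ger0_norm (ltW eps_gt0)) -mulrA ler_pM2l //.
  apply: le_trans (F1D _ _) _; rewrite F1Z -/K4.
  have h3 := HK3 (qq s); have h4 := ler_wpM2r K4_ge0 (mm_le _ _ hzs).
  apply: le_trans (lerD h3 h4) _; rewrite !mulrDr.
  have a1 : K4 * n%:R * `|cc z| <= K * `|cc z| by apply: ler_wpM2r => //.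
  have a2 : K4 * K2 * F1 (pp z) <= K * F1 (pp z) by apply: ler_wpM2r => //.
  have a3 : K3 * F2 (qq s) <= K * F2 (qq s) by apply: ler_wpM2r => //.
  apply: le_trans (lerD (lerD a1 a2) a3).
  by rewrite le_eqVlt; apply/orP; left; apply/eqP; ring.
- have T2sg : T2 *m sg = 0 by rewrite /T2 mulmxBl mul1mx -mulmxA esg mulmx1 subrr.
  have qqT x : qq x = T2 *m x.
    by rewrite /qq /mm /T2 mulmxBl mul1mx -mulmxA [e *m x in RHS]mx11_scalar mul_mx_scalar.
  (* [S] fixes [sg] on the right and [e] on the left, so it commutes with the projection [T2]. *)
  have T2S x : T2 *m (S *m x) = S *m (T2 *m x).
    rewrite !mulmxA; congr (_ *m _).
    by rewrite /T2 mulmxBl mulmxBr mul1mx mulmx1 -mulmxA eS mulmxA Ssg.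
  (* As [P] fixes [o], the difference [z - P *m z] depends on [pp z] alone, so [cc z] does not force
     [qq]. *)
  have -> : qq s' = (S *m qq s + (- eps) *: qq s) + T2 *m (1%:M - P) *m pp z.
    rewrite !qqT /s' mulmxBr mulmxDr T2S -scalemxAr scaleNr.
    rewrite -addrA addrC; congr (_ + _).
    rewrite -mulmxA; congr (_ *m _); rewrite mulmxBl mul1mx /pp mulmxBr -scalemxAr Po.
    by rewrite opprB addrA subrK.
  case: (nF2) => F2D F2Z _.
  apply: le_trans (F2D _ _) _; apply: lerD.
    apply: le_trans (F2D _ _) _; rewrite mulrDl F2Z normrN (ger0_norm (ltW eps_gt0)).
    rewrite lerD2r; apply: le_trans (F2S _ _) _; first exact: mulmx_sub_proj.
    by apply: ler_wpM2r => //; rewrite lerD2l lerN2.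
  apply: le_trans (HK5 _) _; apply: ler_wpM2r => //.
Qed.
End SurplusContraction.

(** * From geometric bounds to limits *)

Lemma geometric_bound_cvg (R : realType) (u : nat -> R) (l C r : R) :
  0 <= r < 1 -> (forall k, `|u k - l| <= C * r ^+ k) -> u @ \oo --> l.
Proof.
move=> /andP[r0 r1] ul.
have cC : (C * r ^+ k @[k --> \oo]) --> (0 : R).
  by rewrite -[X in _ --> X](mulr0 C); apply: cvgMr; apply: cvg_expr; rewrite ger0_norm.
apply: (@squeeze_cvgr _ _ _ _ (fun k => l - C * r ^+ k) (fun k => l + C * r ^+ k)).
- by near=> k; rewrite -ler_distlC distrC.
- by rewrite -[X in _ --> X]subr0; apply: cvgB => //; apply: cvg_cst.
- by rewrite -[X in _ --> X]addr0; apply: cvgD => //; apply: cvg_cst.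
Unshelve. all: by end_near.
Qed.

(** * The matrices of the algorithm: signs, support and stochasticity *)

Section Algorithm.
Variables (R : realType) (n : nat) (E : rel 'I_n) (a b : 'M[R]_n).
Hypotheses (a_upd : updating_weights E a) (b_snd : sending_weights E b).

Let updating_ge0 i j : 0 <= a i j.
Proof.
have [h1 [h2 _]] := a_upd; case: (boolP (E j i)) => [/h1/andP[/ltW]//|/h2->//].
Qed.

Let sending_ge0 i j : 0 <= b i j.
Proof.
have [h1 [h2 _]] := b_snd; case: (boolP (E i j)) => [/h1/andP[/ltW]//|/h2->//].
Qed.

Lemma update_mxE i j :
  (1%:M - Lmx a) i j = (1 - \sum_k a i k) *+ (i == j) + a i j.
Proof.
by rewrite !mxE; case: eqVneq => _; rewrite ?mulr1n ?mulr0n; ring.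
Qed.

Lemma sending_mxE i j :
  Smx b i j = (1 - \sum_k b j k) *+ (i == j) + b j i.
Proof.
rewrite !mxE; case: eqVneq => [->|_]; rewrite ?mulr1n ?mulr0n ?eqxx; ring.
Qed.

Lemma update_mx_ge0 i j : 0 <= (1%:M - Lmx a) i j.
Proof.
have [_ [_ h]] := a_upd.
by rewrite update_mxE addr_ge0 // mulrn_wge0 // subr_ge0 ltW.
Qed.

Lemma sending_mx_ge0 i j : 0 <= Smx b i j.
Proof.
have [_ [_ h]] := b_snd.
by rewrite sending_mxE addr_ge0 // mulrn_wge0 // subr_ge0 ltW.
Qed.

Lemma update_mx_diag_gt0 i : 0 < (1%:M - Lmx a) i i.
Proof.
by have [_ [_ h]] := a_upd; rewrite update_mxE eqxx ltr_pwDl // subr_gt0.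
Qed.

Lemma sending_mx_diag_gt0 i : 0 < Smx b i i.
Proof.
by have [_ [_ h]] := b_snd; rewrite sending_mxE eqxx ltr_pwDl // subr_gt0.
Qed.

Lemma update_mx_edge_gt0 i j : E j i -> 0 < (1%:M - Lmx a) i j.
Proof.
have [h1 [_ h]] := a_upd; move=> /h1/andP[aij _].
by rewrite update_mxE ltr_wpDl // mulrn_wge0 // subr_ge0 ltW.
Qed.

Lemma sending_mx_edge_gt0 i j : E j i -> 0 < Smx b i j.
Proof.
have [h1 [_ h]] := b_snd; move=> /h1/andP[bij _].
by rewrite sending_mxE ltr_wpDl // mulrn_wge0 // subr_ge0 ltW.
Qed.

Lemma update_mx_off_edge i j : i != j -> ~~ E j i -> (1%:M - Lmx a) i j = 0.
Proof.
have [_ [h _]] := a_upd.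
by move=> /negPf ij /h aij; rewrite update_mxE ij mulr0n add0r.
Qed.

Lemma sending_mx_off_edge i j : i != j -> ~~ E j i -> Smx b i j = 0.
Proof.
have [_ [h _]] := b_snd.
by move=> /negPf ij /h bij; rewrite sending_mxE ij mulr0n add0r.
Qed.

Lemma update_mx_row_stochastic :
  (1%:M - Lmx a) *m const_mx 1 = const_mx 1 :> 'cV[R]_n.
Proof.
apply/colP => i; rewrite [LHS]mxE [RHS]mxE.
under eq_bigr do rewrite update_mxE mxE mulr1.
rewrite big_split /= (bigD1 i) //= eqxx mulr1n [X in _ + X + _]big1 ?addr0 ?subrK //.
by move=> j /negPf; rewrite eq_sym => ->.
Qed.

Lemma sending_mx_col_stochastic :
  const_mx 1 *m Smx b = const_mx 1 :> 'rV[R]_n.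
Proof.
apply/rowP => i; rewrite [LHS]mxE [RHS]mxE.
under eq_bigr do rewrite sending_mxE mxE mul1r.
rewrite big_split /= (bigD1 i) //= eqxx mulr1n [X in _ + X + _]big1 ?addr0 ?subrK //.
by move=> j /negPf ->.
Qed.

(** * Trajectories and the two implications *)

Lemma xstateS eps x0 k : xstate a b eps x0 k.+1 =
  (1%:M - Lmx a) *m xstate a b eps x0 k + eps *: sstate a b eps x0 k.
Proof.
rewrite /xstate /sstate /traj /= -/(traj a b eps x0 k).
rewrite -{1}[traj _ _ _ _ _]vsubmxK mul_block_col col_mxKu.
by rewrite mul_scalar_mx.
Qed.

(** Writing L x as x - P x gives the recursion the shape treated in [surplus_contraction]. *)
Lemma sstateS eps x0 k : sstate a b eps x0 k.+1 =
  xstate a b eps x0 k - (1%:M - Lmx a) *m xstate a b eps x0 k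
  + Smx b *m sstate a b eps x0 k - eps *: sstate a b eps x0 k.
Proof.
rewrite /xstate /sstate /traj /= -/(traj a b eps x0 k).
rewrite -{1}[traj _ _ _ _ _]vsubmxK mul_block_col col_mxKd.
by rewrite [(Smx b - _) *m _]mulmxBl mul_scalar_mx addrA [(1%:M - _) *m _]mulmxBl mul1mx subKr.
Qed.

Lemma strongly_connected_consensus : (0 < n)%N -> strongly_connected E ->
  exists epsb : R, 0 < epsb /\
    forall eps : R, 0 < eps -> eps < epsb -> achieves_average_consensus a b eps.
Proof.
move=> n0 sc.
have [N PN] := primitive_expmx update_mx_ge0 update_mx_diag_gt0 update_mx_edge_gt0 sc.
have [N' SN] := primitive_expmx sending_mx_ge0 sending_mx_diag_gt0 sending_mx_edge_gt0 sc.
have [epsb epsb0 H] := surplus_contraction n0 update_mx_ge0 PN update_mx_row_stochastic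
  sending_mx_ge0 SN sending_mx_col_stochastic.
exists epsb; split=> // eps eps0 epsl; have {H} := H eps.
rewrite eps0 epsl => /(_ isT)[W [C [rho [rho01 C0 HC HW]]]] x0.
set P := 1%:M - Lmx a in HW.
pose e : 'rV[R]_n := const_mx 1.
pose o : 'cV[R]_n := const_mx 1.
pose z k := xstate a b eps x0 k - average x0 *: o.
pose s k := sstate a b eps x0 k.
have Po : P *m o = o by exact: update_mx_row_stochastic.
have zS k : z k.+1 = P *m z k + eps *: s k.
  by rewrite /z xstateS mulmxBr -scalemxAr Po addrAC.
have sS k : s k.+1 = z k - P *m z k + Smx b *m s k - eps *: s k.
  rewrite /s sstateS /z mulmxBr -scalemxAr Po; congr (_ + _ - _).
  by rewrite [- (_ - average x0 *: o)]opprB subrKA.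
(* Whatever leaves [z] enters [s] and conversely, and [S] has unit column sums; at time 0 the
   surplus vanishes and [z] is centred at the average. *)
have zs k : e *m (z k + s k) = 0.
  elim: k => [|k IH].
    rewrite /z /s /xstate /sstate /traj /= col_mxKu col_mxKd addr0.
    apply/matrixP => i j; rewrite !ord1 mulmxBr -scalemxAr !mxE.
    under eq_bigr do rewrite mxE mul1r; under [X in _ * X]eq_bigr do rewrite !mxE mulr1.
    rewrite sumr_const card_ord /average mulfVK ?subrr //.
    by rewrite pnatr_eq0 -lt0n.
  rewrite zS sS -[RHS]IH.
  have -> : P *m z k + eps *: s k + (z k - P *m z k + Smx b *m s k - eps *: s k) =
            z k + Smx b *m s k.
    by rewrite [P *m z k + _]addrC [LHS]addrC addrA subrK addrAC subrK.
  by rewrite !mulmxDr mulmxA sending_mx_col_stochastic.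
have Wk k : W (z k) (s k) <= W (z 0%N) (s 0%N) * rho ^+ k.
  elim: k => [|k IH]; first by rewrite expr0 mulr1.
  rewrite zS sS; apply: le_trans (HW _ _ (zs k)) _.
  by rewrite exprS mulrCA ler_wpM2l //; case/andP: rho01.
split=> i.
- apply: (@geometric_bound_cvg _ _ _ (C * W (z 0%N) (s 0%N)) rho) => // k.
  have -> : xstate a b eps x0 k i 0 - average x0 = z k i 0 by rewrite !mxE mulr1.
  have [h _] := HC (z k) (s k) i; apply: le_trans h _.
  by rewrite -mulrA ler_wpM2l.
- apply: (@geometric_bound_cvg _ _ _ (C * W (z 0%N) (s 0%N)) rho) => // k.
  rewrite subr0; have [_ h] := HC (z k) (s k) i; apply: le_trans (h (zs k)) _.
  by rewrite -mulrA ler_wpM2l.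
Qed.

(** Every in-neighbour of a node unreachable from [i] is itself unreachable, and off-diagonal
    entries of both matrices live on edges, so zeros on the unreachable set persist. *)
Lemma unreachable_state0 eps (i : 'I_n) k (j : 'I_n) : ~~ connect E i j ->
  let x0 := \col_h (connect E i h)%:R in
  xstate a b eps x0 k j 0 = 0 /\ sstate a b eps x0 k j 0 = 0.
Proof.
move=> + x0.
have sum0 (Q : 'M[R]_n) (y : 'cV[R]_n) h :
    (forall i j, i != j -> ~~ E j i -> Q i j = 0) ->
    (forall h, ~~ connect E i h -> y h 0 = 0) -> ~~ connect E i h -> (Q *m y) h 0 = 0.
  move=> Q0 y0 ih; rewrite mxE big1 // => l _.
  have [il|/y0->] := boolP (connect E i l); last by rewrite mulr0.
  rewrite Q0 ?mul0r //; first by apply: contraNneq ih => ->.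
  by apply: contra ih => El; apply: connect_trans il (connect1 El).
elim: k j => [|k IH] j ij.
  by rewrite /xstate /sstate /traj /= col_mxKu col_mxKd !mxE (negPf ij).
have xk h : ~~ connect E i h -> xstate a b eps x0 k h 0 = 0 by move=> /IH[].
have sk h : ~~ connect E i h -> sstate a b eps x0 k h 0 = 0 by move=> /IH[].
have Px := sum0 _ _ _ update_mx_off_edge xk ij.
have Ss := sum0 _ _ _ sending_mx_off_edge sk ij.
rewrite xstateS sstateS; move: Px Ss (xk _ ij) (sk _ ij).
move: (xstate _ _ _ _ _) (sstate _ _ _ _ _) ((1%:M - Lmx a) *m _) (Smx b *m _).
by move=> x s Px Ss Px0 Ss0 xj sj; rewrite !mxE Px0 Ss0 xj sj !(mulr0, addr0, subr0).
Qed.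

Lemma consensus_strongly_connected eps : (0 < n)%N ->
  achieves_average_consensus a b eps -> strongly_connected E.
Proof.
move=> n0 cons i j; apply/negPn/negP => ij.
pose x0 : 'cV[R]_n := \col_h (connect E i h)%:R.
have [/(_ j) xj _] := cons x0.
(* The state at [j] is constantly 0, so its limit, the average, is 0; yet node [i] contributes 1 to
   the sum. *)
have avg0 : average x0 = 0.
  apply: (@cvg_unique _ _ _ _ _ _ xj) => //.
  rewrite (_ : (fun k => _) = fun=> 0); first exact: cvg_cst.
  by apply/funext => k; have [] := unreachable_state0 eps k ij.
suff : 0 < average x0 by rewrite avg0 ltxx.
rewrite divr_gt0 ?ltr0n // (bigD1 i) //= mxE connect0 ltr_pwDl //.
by apply: sumr_ge0 => h _; rewrite mxE ler0n.
Qed.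

End Algorithm.

Theorem theorem1 (R : realType) (n : nat) (E : rel 'I_n)
    (a b : 'M[R]_n) :
  (1 < n)%N ->
  (forall i : 'I_n, ~~ E i i) ->
  updating_weights E a ->
  sending_weights E b ->
  (strongly_connected E <->
  exists epsb : R, 0 < epsb /\
    forall eps : R, 0 < eps -> eps < epsb ->
      achieves_average_consensus a b eps).
Proof.
move=> n1 _ a_upd b_snd; have n0 := ltnW n1; split.
  exact: strongly_connected_consensus.
move=> [epsb [epsb0 cons]].
(* A single admissible parameter suffices; [epsb / 2] is one. *)
apply: (consensus_strongly_connected a_upd b_snd n0 (cons (epsb / 2) _ _)).
  by rewrite divr_gt0.
by rewrite ltr_pdivrMr // mulr_natr mulr2n ltrDl.
Qed.
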